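(* For any graph $G$ on $n$ vertices, \[ L_{\circ}(G) \geq \frac{1}{2}\log \iota(G) - 8\log^*\! n. \]
   Context: All graphs are finite and simple. For nonempty $X \subseteq V(G)$, $\alpha(X)$ is the independence number of the subgraph induced by $X$, and $\iota(G) := \sup_{\emptyset\neq X \subseteq V(G)} |X|/\alpha(X)$. $C_\circ(G)$ is the set of integers $t$ such that $G$ contains a cycle of odd length $t$, and $L_\circ(G) := \sum_{t \in C_\circ(G)} 1/t$. $\log$ is the natural logarithm, and $\log^*\! n$ is the number of times the natural logarithm must be applied to $n$ to get a number less than one. *)

(* Defs.v *)
From mathcomp Require Import all_boot all_order all_algebra.
From mathcomp Require Import all_classical all_reals all_analysis.

Set Implicit Arguments.
Unset Strict Implicit.
Unset Printing Implicit Defensive.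

Import Order.TTheory GRing.Theory Num.Theory.

Local Open Scope ring_scope.

(* A finite simple graph is a finite type of vertices with a symmetric,
   irreflexive adjacency relation e. *)

Definition independent (T : finType) (e : rel T) (I : {set T}) : bool :=
  [forall x in I, forall y in I, ~~ e x y].

Definition alpha (T : finType) (e : rel T) (X : {set T}) : nat :=
  \max_(I : {set T} | (I \subset X) && independent e I) #|I|.

Definition iota_ratio (R : realType) (T : finType) (e : rel T) : R :=
  sup [set r : R | exists2 X : {set T},
                     X != finset.set0 & r = #|X|%:R / (alpha e X)%:R]%classic.

Definition has_cycle (T : finType) (e : rel T) (t : nat) : bool :=
  (2 < t)%N && [exists c : t.-tuple T, ucycleb e c].

Definition odd_cycle_length (T : finType) (e : rel T) : pred nat :=
  [pred t | odd t && has_cycle e t].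

(* A cycle has at most #|T| vertices, so this range meets every odd cycle
   length. *)
Definition Lodd (R : realType) (T : finType) (e : rel T) : R :=
  \sum_(t < #|T|.+1 | odd_cycle_length e t) (t%:R)^-1.

Lemma iter_ln_lt1 (R : realType) (x : R) : exists k, iter k (@ln R) x < 1.
Proof.
suff H k : (exists j, iter j (@ln R) x < 1) \/ iter k (@ln R) x <= x - k%:R.
  have [//|xk] := H (Num.truncn x); exists (Num.truncn x).
  by rewrite (le_lt_trans xk)// ltrBlDr addrC natr1 truncnS_gt.
elim: k => [|k [|IH]]; [by right; rewrite subr0 | by left |].
have [lt1|ge1] := ltP (iter k (@ln R) x) 1; first by left; exists k.
right; rewrite iterS -natr1 opprD addrA (le_trans _ (lerB IH (lexx 1)))//.
rewrite -[in X in ln X](subrK 1 (iter k _ x)) [X in ln X]addrC le_ln1Dx//.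
by rewrite ltrBrDr addNr (lt_le_trans _ ge1).
Qed.

(* ln is only ever applied to numbers >= 1 here, so its value on nonpositive
   reals is irrelevant. *)
Definition logstar (R : realType) (x : R) : nat := ex_minn (iter_ln_lt1 x).

(* Main.v *)
(* Write iota for |X| / alpha(X), n for |X|.
   - In a set Z of minimal size with |Z| >= q alpha(Z), every F satisfies
     |F u N_Z(F)| >= q alpha(F), and Z is connected.
   - By ball growing, if q is at most about iota / 4, some such Z lies in a single
     layer of a breadth-first search of depth O(log n).  Two vertices of Z whose
     ancestors first meet J levels up, joined by an odd path of length l in Z,
     give an odd cycle of length l + 2J.  Colour Z by the ancestor just below the
     common ancestor of all of Z: a long path in Z forces, for every odd l up to a
     fixed fraction of its length, a two-coloured path of length exactly l.
   - Long paths come from depth-first search as soon as small sets F expand.  So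
     either all F with |F| = O(iota log n) have alpha(F) > 20 |F| / iota, and then
     all odd lengths 2J + 1, ..., 2J + iota (2J + 1) occur for some J, which
     gives L >= (log iota) / 2; or some F with |F| = O(iota log n) has ratio at
     least iota / 20.
   - Applying this twice, iota drops by a constant factor and n is replaced by at
     most log n, unless log n < iota ^ 4, where n becomes polynomial in iota.  In
     the polynomial case the same argument, with balls growing by the factor
     iota / (60 k) for k steps, shows that no cycle length 2k + 1 with
     16 <= k <= iota / 120 is missing. *)

Require Import Defs.
From mathcomp Require Import all_boot all_order all_algebra.
From mathcomp Require Import zify ring lra.

Set Implicit Arguments.
Unset Strict Implicit.
Unset Printing Implicit Defensive.

Import Order.TTheory GRing.Theory Num.Theory.
Local Open Scope ring_scope.

Section Independence.
Variables (T : finType) (e : rel T).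
Hypotheses (e_sym : symmetric e) (e_irr : irreflexive e).
Implicit Types (X Y Z S I N : {set T}).

Definition nbh S : {set T} := [set y | [exists x in S, e x y]].

Definition anticomplete X Y := forall x y, x \in X -> y \in Y -> ~~ e x y.

Lemma nbhP S y : reflect (exists2 x, x \in S & e x y) (y \in nbh S).
Proof. by rewrite inE; apply: (iffP exists_inP). Qed.

Lemma independentP I :
  reflect {in I &, forall x y, ~~ e x y} (independent e I).
Proof.
apply: (iffP forall_inP) => [H x y xI yI|H x xI]; first exact: (forall_inP (H x xI)).
by apply/forall_inP => y; apply: H.
Qed.

Lemma independent0 : independent e set0.
Proof. by apply/independentP => x y; rewrite inE. Qed.

Lemma independent1 x : independent e [set x].
Proof. by apply/independentP => y z /set1P-> /set1P->; rewrite e_irr. Qed.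

Lemma alpha_witness X :
  exists I, [/\ I \subset X, independent e I & #|I| = alpha e X].
Proof.
have [|I /andP[IX Iind] EI] :=
  @eq_bigmax_cond _ [pred I : {set T} | (I \subset X) && independent e I] (fun I => #|I|).
  by apply/card_gt0P; exists set0; rewrite !inE sub0set independent0.
by exists I; split=> //; rewrite -EI.
Qed.

Lemma leq_alpha X I : I \subset X -> independent e I -> (#|I| <= alpha e X)%N.
Proof. by move=> IX Iind; apply: leq_bigmax_cond; rewrite IX Iind. Qed.

Lemma alphaS X Y : X \subset Y -> (alpha e X <= alpha e Y)%N.
Proof.
have [I [IX Iind <-]] := alpha_witness X.
by move=> XY; apply: leq_alpha => //; apply: subset_trans XY.
Qed.

Lemma alpha_gt0 X : X != set0 -> (0 < alpha e X)%N.
Proof.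
case/set0Pn=> x xX; rewrite -(cards1 x); apply: leq_alpha (independent1 x).
by rewrite sub1set.
Qed.

Lemma alphaU X Y : [disjoint X & Y] -> anticomplete X Y ->
  (alpha e X + alpha e Y <= alpha e (X :|: Y))%N.
Proof.
move=> dXY XY; have [I [IX Iind <-]] := alpha_witness X.
have [J [JY Jind <-]] := alpha_witness Y.
have dIJ: [disjoint I & J] by apply: disjointWl IX _; apply: disjointWr JY _.
have -> : (#|I| + #|J| = #|I :|: J|)%N.
  by apply/esym/eqP; rewrite (leq_card_setU I J).2.
apply: leq_alpha; first exact: setUSS.
apply/independentP => x y /setUP[xI|xJ] /setUP[yI|yJ].
- exact: (independentP _ Iind).
- exact: XY (subsetP IX _ xI) (subsetP JY _ yJ).
- by rewrite e_sym; apply: XY (subsetP IX _ yI) (subsetP JY _ xJ).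
- exact: (independentP _ Jind).
Qed.

Lemma alpha_remove Z I : I \subset Z -> independent e I ->
  (alpha e (Z :\: (I :|: nbh I)) + #|I| <= alpha e Z)%N.
Proof.
move=> IZ Iind; set W := Z :\: _.
have WI: anticomplete W I.
  move=> x y; rewrite !inE negb_or => /andP[/andP[_ xn] _] yI.
  by apply: contraNN xn => exy; apply/exists_inP; exists y; rewrite // e_sym.
have dWI: [disjoint W & I].
  rewrite -setI_eq0; apply/eqP/setP=> x; rewrite !inE.
  by case: (x \in I) => //=; rewrite andbF.
apply: leq_trans (_ : alpha e (W :|: I) <= _)%N; last first.
  by apply: alphaS; rewrite subUset IZ subsetDl.
by apply: leq_trans (alphaU dWI WI); rewrite leq_add2l leq_alpha.
Qed.

Section Critical.
Variable R : realFieldType.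
Implicit Type q : R.

Definition critical q Z :=
  [/\ Z != set0, q * (alpha e Z)%:R <= #|Z|%:R &
      forall Z', Z' \proper Z -> Z' != set0 -> #|Z'|%:R < q * (alpha e Z')%:R].

Lemma exists_critical q N : N != set0 -> q * (alpha e N)%:R <= #|N|%:R ->
  exists2 Z : {set T}, Z \subset N & critical q Z.
Proof.
move=> N0 qN.
pose P := [pred Z : {set T} | (Z != set0) && (q * (alpha e Z)%:R <= #|Z|%:R)].
have PN : P N by rewrite /= N0.
have [Z /minsetP[/andP[Z0 qZ] Zmin] ZN] := minset_exists PN.
exists Z => //; split=> // Z' Z'Z Z'0; rewrite ltNge; apply/negP => qZ'.
have /eqP : Z' == Z by apply/eqP/Zmin; rewrite ?proper_sub //= Z'0.
by move=> E; rewrite E properxx in Z'Z.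
Qed.

Lemma critical_connected q Z X Y : critical q Z -> X != set0 -> Y != set0 ->
  [disjoint X & Y] -> X :|: Y = Z -> ~ anticomplete X Y.
Proof.
move=> [Z0 qZ Zmin] X0 Y0 dXY XYZ XY.
have cardZ: #|Z| = (#|X| + #|Y|)%N.
  by apply/eqP; rewrite -XYZ (leq_card_setU X Y).2.
have XZ: X \proper Z.
  rewrite properEcard -XYZ subsetUl XYZ cardZ -[X in (X < _)%N]addn0 ltn_add2l.
  by rewrite card_gt0.
have YZ: Y \proper Z.
  rewrite properEcard -XYZ subsetUr XYZ cardZ -[X in (X < _)%N]add0n ltn_add2r.
  by rewrite card_gt0.
have := ltrD (Zmin _ XZ X0) (Zmin _ YZ Y0).
rewrite -natrD -cardZ -mulrDr -natrD ltNge => /negP; apply.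
have [q0|q0] := leP 0 q.
  by apply: le_trans qZ; rewrite ler_wpM2l // ler_nat -XYZ alphaU.
by apply: le_trans (ler0n _ _); rewrite nmulr_rle0.
Qed.

Lemma critical_expansion q Z S : critical q Z -> S \subset Z ->
  q * (alpha e S)%:R <= #|(S :|: nbh S) :&: Z|%:R.
Proof.
move=> [Z0 qZ Zmin] SZ.
have [q0|q0] := leP q 0; first by apply: le_trans (ler0n _ _); apply: mulr_le0_ge0.
have [I [IS Iind <-]] := alpha_witness S.
have IZ := subset_trans IS SZ.
apply: (@le_trans _ _ #|(I :|: nbh I) :&: Z|%:R); last first.
  rewrite ler_nat; apply/subset_leq_card/setSI/setUSS => //.
  by apply/subsetP=> y /nbhP[x /(subsetP IS) xS exy]; apply/nbhP; exists x.
have cardZ: (#|Z :\: (I :|: nbh I)| + #|(I :|: nbh I) :&: Z| = #|Z|)%N.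
  by rewrite addnC setIC cardsID.
have aZ := alpha_remove IZ Iind.
have [W0|W0] := eqVneq (Z :\: (I :|: nbh I)) set0.
  move: cardZ; rewrite W0 cards0 add0n => ->; apply: le_trans qZ.
  by rewrite ler_pM2l // ler_nat (leq_trans _ aZ) // leq_addl.
have [->|I0] := eqVneq I set0; first by rewrite cards0 mulr0 ler0n.
have WZ: Z :\: (I :|: nbh I) \proper Z.
  case/set0Pn: I0 => x xI; rewrite properE subsetDl; apply/subsetPn.
  by exists x; rewrite ?(subsetP IZ) // !inE xI.
have wlt := Zmin _ WZ W0; set W := Z :\: _ in aZ cardZ wlt.
have qaZ : q * ((alpha e W)%:R + #|I|%:R) <= q * (alpha e Z)%:R.
  by rewrite ler_pM2l // -natrD ler_nat.
by move: qZ qaZ wlt; rewrite mulrDr -cardZ natrD; lra.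
Qed.

End Critical.

Definition spath Z (p : seq T) := [&& sorted e p, uniq p & all [in Z] p].

(* Depth-first search, stopped when exactly [s] vertices are finished: their
   unfinished neighbours all lie on the current stack. *)
Lemma dfs_path Z s : (s <= #|Z|)%N ->
  exists (F : {set T}) (p : seq T), [/\ F \subset Z, #|F| = s, spath Z p &
    (#|(F :|: nbh F) :&: Z| <= size p + s)%N].
Proof.
pose state (F : {set T}) p :=
  [/\ F \subset Z, spath Z p, {in p, forall x, x \notin F} &
  forall x y, x \in F -> y \in Z -> e x y -> (y \in F) || (y \in p)].
move=> sZ; suff [F [p [Fs [FZ Pp pF nF]]]] :
    exists (F : {set T}) (p : seq T), #|F| = s /\ state F p.
  exists F, p; split=> //; rewrite -Fs -(card_uniqP _); last by case/and3P: Pp.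
  rewrite addnC -[#|p|]cardsE.
  apply: leq_trans (leq_card_setU F [set x in p]).1.
  apply/subset_leq_card/subsetP=> y; rewrite !inE => /andP[/orP[->//|]].
  by case/exists_inP=> x xF exy yZ; apply: nF exy.
elim: s => [|s IHs] in sZ *.
  exists set0, [::]; split; first by rewrite cards0.
  by split; rewrite ?sub0set // => x y; rewrite inE.
have {IHs} [F [p [Fs Fp]]] := IHs (ltnW sZ).
have [m] := ubnP (#|Z| - size p)%N; elim: m => // m IHm in p Fp *.
have [FZ /and3P[ep up /allP pZ] pF nF] := Fp; move=> lem.
have push x p' : x \in Z -> x \notin F -> x \notin p -> p' = x :: p ->
    sorted e p' -> exists (F : {set T}) (p : seq T), #|F| = s.+1 /\ state F p.
  move=> xZ xF xp Ep' ep'; apply: (IHm p'); last first.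
    have : (size p' <= #|Z|)%N.
      rewrite -(card_uniqP _) ?Ep' /= ?xp //; apply/subset_leq_card/subsetP=> y.
      by rewrite inE => /predU1P[->|/pZ].
    by move: lem; rewrite Ep' /=; lia.
  split=> //.
  - by rewrite /spath ep' Ep' /= xp up xZ; apply/allP.
  - by move=> y; rewrite Ep' inE => /predU1P[->|/pF].
  - by move=> y z yF zZ /(nF y z yF zZ)/orP[->//|zp]; rewrite Ep' inE zp !orbT.
case: p => [|x p] in ep up pZ pF nF push lem {Fp} *.
  have [x] : exists x, x \in Z :\: F.
    by apply/set0Pn; rewrite -card_gt0 cardsDS // Fs subn_gt0.
  by rewrite inE => /andP[xF xZ]; apply: (push x).
case: (pickP [pred y | [&& y \in Z, y \notin F, y \notin x :: p & e x y]]) => [y|none].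
  case/and4P=> yZ yF yp exy; apply: (push y [:: y, x & p]) => //=.
  by rewrite e_sym exy.
have xF : x \notin F by apply: pF; rewrite mem_head.
exists (x |: F), p; split; first by rewrite cardsU1 xF Fs.
have xZ : x \in Z by apply: pZ; rewrite mem_head.
move: up => /= /andP[xp up]; split.
- by rewrite subUset sub1set xZ FZ.
- rewrite /spath up (path_sorted ep); apply/allP => y yp.
  by apply: pZ; rewrite inE yp orbT.
- move=> y yp; rewrite !inE negb_or pF ?inE ?yp ?orbT // andbT.
  by apply: contraNneq xp => <-.
- move=> y z /setU1P[->|yF] zZ eyz; last first.
    have := nF y z yF zZ eyz; rewrite !inE.
    by case: (z == x); case: (z \in F).
  have := none z; rewrite /= zZ eyz andbT !inE.
  by case: (z \in F); case: (z == x); case: (z \in p).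
Qed.

End Independence.

Section Layers.
Variables (T : finType) (e : rel T).
Hypotheses (e_sym : symmetric e) (e_irr : irreflexive e).
Implicit Types (X Y Z : {set T}).

Fixpoint bfs Y v i : {set T} :=
  if i is j.+1 then bfs Y v j :|: (nbh e (bfs Y v j) :&: Y) else [set v].

Definition layer Y v i : {set T} :=
  if i is j.+1 then bfs Y v j.+1 :\: bfs Y v j else [set v].

Lemma bfs_leq Y v i j : (i <= j)%N -> bfs Y v i \subset bfs Y v j.
Proof.
move=> /subnKC <-; elim: (j - i)%N => [|k IHk]; first by rewrite addn0.
by rewrite addnS; apply: subset_trans IHk _; apply: subsetUl.
Qed.

Lemma bfs_sub Y v i : v \in Y -> bfs Y v i \subset Y.
Proof.
move=> vY; elim: i => [|i IHi] /=; first by rewrite sub1set.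
by rewrite subUset IHi subsetIr.
Qed.

Lemma layer_bfs Y v i : layer Y v i \subset bfs Y v i.
Proof. by case: i => [|i] //=; apply: subsetDl. Qed.

Lemma layer_sub Y v i : v \in Y -> layer Y v i \subset Y.
Proof. by move=> vY; apply: subset_trans (layer_bfs _ _ _) (bfs_sub _ vY). Qed.

Lemma layer_notin_bfs Y v i j u : u \in layer Y v j -> (i < j)%N -> u \notin bfs Y v i.
Proof.
case: j => // j; rewrite inE => /andP[un _] ij.
by apply: contraNN un => ui; apply: subsetP ui; apply: bfs_leq.
Qed.

Lemma layer_inj Y v i j u : u \in layer Y v i -> u \in layer Y v j -> i = j.
Proof.
wlog ij : i j / (i <= j)%N => [H ui uj|ui uj].
  by have [/H|/ltnW /H H'] := leqP i j; [exact | apply/esym/H'].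
apply/eqP; rewrite eqn_leq ij leqNgt; apply/negP => /(layer_notin_bfs uj).
by rewrite (subsetP (layer_bfs _ _ _) _ ui).
Qed.

Lemma bfs_edge Y v i x y : x \in bfs Y v i -> y \in Y -> e x y -> y \in bfs Y v i.+1.
Proof.
move=> xi yY exy; rewrite inE; apply/orP; right; rewrite !inE yY andbT.
by apply/exists_inP; exists x.
Qed.

Lemma layer_edge Y v i j x y : v \in Y -> x \in layer Y v i -> y \in layer Y v j ->
  e x y -> (j <= i.+1)%N.
Proof.
move=> vY xi yj exy; rewrite leqNgt; apply/negP => /(layer_notin_bfs yj) /negP; apply.
by apply: bfs_edge exy; [apply: subsetP xi; apply: layer_bfs |
  apply: subsetP yj; apply: layer_sub].
Qed.

Lemma layer_parent Y v i u : u \in layer Y v i.+1 ->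
  exists2 w, w \in layer Y v i & e u w.
Proof.
rewrite inE => /andP[un]; rewrite inE (negPf un) /= inE => /andP[/nbhP[w wi ewu] uY].
exists w; last by rewrite e_sym.
case: i => // i in un wi *; rewrite inE wi andbT; apply: contraNN un => wi'.
exact: bfs_edge ewu.
Qed.

Lemma bfs_layer Y v i u : u \in bfs Y v i -> exists2 j, (j <= i)%N & u \in layer Y v j.
Proof.
elim: i => [|i IHi] ui; first by exists 0%N.
have [/IHi[j ji uj]|un] := boolP (u \in bfs Y v i); first by exists j => //; apply: leqW.
by exists i.+1; rewrite // inE un ui.
Qed.

Section Decomposition.
Variable R : realFieldType.
Implicit Types q rho : R.

(* The layers of one parity are pairwise anticomplete, so large independent sets
   of the individual layers can be glued together. *)
Lemma bfs_alpha q Y v r : 0 <= q -> v \in Y ->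
  (forall j, (j <= r)%N -> #|layer Y v j|%:R <= q * (alpha e (layer Y v j))%:R) ->
  #|bfs Y v r|%:R <= 2 * q * (alpha e (bfs Y v r))%:R.
Proof.
move=> q0 vY; pose W b k := [set u | [exists j : 'I_k, (odd j == b) && (u \in layer Y v j)]].
move=> Hlayer.
have Hb b k : (k <= r.+1)%N -> #|W b k|%:R <= q * (alpha e (W b k))%:R.
  elim: k => [|k IHk] kr.
    have -> : W b 0%N = set0 by apply/setP=> u; rewrite !inE; apply/existsP => -[[]].
    by rewrite cards0 mulr_ge0.
  have Wk : W b k.+1 = if odd k == b then W b k :|: layer Y v k else W b k.
    apply/setP=> u; rewrite inE; apply/existsP/idP => [[j /andP[jb uj]]|].
      have [jk|jk] := ltnP j k.
        have : u \in W b k by rewrite inE; apply/existsP; exists (Ordinal jk); rewrite jb.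
        by case: ifP => // _; rewrite in_setU => ->.
      have E : j = k :> nat by apply/eqP; rewrite eqn_leq jk -ltnS ltn_ord.
      by rewrite E in jb uj; rewrite jb inE uj orbT.
    have Wsub : u \in W b k -> exists x : 'I_k.+1, (odd x == b) && (u \in layer Y v x).
      by rewrite inE => /existsP[j Hj]; exists (widen_ord (leqnSn k) j).
    case: ifP => // kb /setUP[/Wsub//|uk].
    by exists ord_max; rewrite kb.
  rewrite Wk; case: ifP => kb; last exact: IHk (ltnW kr).
  have Wj u : u \in W b k -> exists2 j, (j.+2 <= k)%N & u \in layer Y v j.
    rewrite inE => /existsP[j /andP[/eqP jb uj]]; exists j => //.
    rewrite ltn_neqAle ltn_ord andbT; apply/negP => /eqP E.
    by move: kb; rewrite -E /= jb; case: b {Wk IHk jb}.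
  have dW : [disjoint W b k & layer Y v k].
    rewrite -setI_eq0; apply/eqP/setP=> u; rewrite in_setI in_set0.
    apply/negP => /andP[/Wj[j jk uj] uk].
    by move: jk; rewrite (layer_inj uj uk) ltnNge leqnSn.
  have aW : anticomplete e (W b k) (layer Y v k).
    move=> x y /Wj[j jk xj] yk; apply/negP => /(layer_edge vY xj yk).
    by rewrite leqNgt jk.
  have -> : #|W b k :|: layer Y v k| = (#|W b k| + #|layer Y v k|)%N.
    by apply/eqP; rewrite (leq_card_setU _ _).2.
  rewrite natrD; apply: le_trans (lerD (IHk (ltnW kr)) (Hlayer _ kr)) _.
  by rewrite -mulrDr ler_wpM2l // -natrD ler_nat alphaU.
have sub b : W b r.+1 \subset bfs Y v r.
  apply/subsetP=> u; rewrite inE => /existsP[j /andP[_ uj]].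
  by apply: subsetP (subsetP (layer_bfs _ _ _) _ uj); apply: bfs_leq; rewrite -ltnS.
have cov : bfs Y v r \subset W true r.+1 :|: W false r.+1.
  apply/subsetP=> u /bfs_layer[j jr uj]; rewrite !inE.
  by case jb : (odd j); apply/orP; [left|right]; apply/existsP;
     exists (Ordinal (jr : (j < r.+1)%N)); rewrite /= jb.
apply: (@le_trans _ _ (#|W true r.+1| + #|W false r.+1|)%:R).
  by rewrite ler_nat (leq_trans (subset_leq_card cov)) // (leq_card_setU _ _).1.
have aS b : q * (alpha e (W b r.+1))%:R <= q * (alpha e (bfs Y v r))%:R.
  by rewrite ler_wpM2l // ler_nat alphaS.
rewrite natrD -mulrA mulr2n mulrDl mul1r; apply: lerD; apply: le_trans (aS _); exact: Hb.
Qed.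

(* Repeatedly delete a ball of radius [i.+1] that is at most [rho] times larger than
   its concentric ball of radius [i], which is kept. *)
Lemma bfs_decomposition q rho r X : 0 <= q -> 1 <= rho ->
  #|X|%:R < rho ^+ r.+1 ->
  (forall Y v j, Y \subset X -> v \in Y -> (j <= r)%N ->
     #|layer Y v j|%:R <= q * (alpha e (layer Y v j))%:R) ->
  #|X|%:R <= 2 * q * rho * (alpha e X)%:R.
Proof.
move=> q0 rho1 Xr Hlayer.
have rho0 : 0 <= rho by apply: le_trans rho1.
suff H m Y : (#|Y| < m)%N -> Y \subset X -> #|Y|%:R <= 2 * q * rho * (alpha e Y)%:R.
  exact: H (ltnSn _) (subxx _).
elim: m Y => // m IHm Y Ym YX.
have [->|/set0Pn[v vY]] := eqVneq Y set0; first by rewrite cards0 !mulr_ge0.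
have [i ir gi] : exists2 i, (i <= r)%N & #|bfs Y v i.+1|%:R <= rho * #|bfs Y v i|%:R.
  have [/existsP[i Hi]|none] :=
      boolP [exists i : 'I_r.+1, #|bfs Y v i.+1|%:R <= rho * #|bfs Y v i|%:R].
    by exists i; rewrite // -ltnS.
  suff growth k : (k <= r.+1)%N -> rho ^+ k <= #|bfs Y v k|%:R.
    have := lt_le_trans Xr (growth _ (leqnn _)); rewrite ltr_nat ltnNge.
    by rewrite (leq_trans (subset_leq_card (bfs_sub _ vY))) // subset_leq_card.
  elim: k => [|k IHk] kr; first by rewrite cards1.
  have := existsPn none (Ordinal kr); rewrite -ltNge /= => H.
  by apply: le_trans (ltW H); rewrite exprS ler_wpM2l // IHk // ltnW.
have bY := bfs_sub i.+1 vY; have bb : bfs Y v i \subset bfs Y v i.+1 by apply: bfs_leq.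
pose Y' := Y :\: bfs Y v i.+1.
have cY : #|Y| = (#|bfs Y v i.+1| + #|Y'|)%N.
  by rewrite -(cardsID (bfs Y v i.+1) Y) (setIidPr bY).
have Y'm : (#|Y'| < m)%N.
  have : (0 < #|bfs Y v i.+1|)%N.
    by apply/card_gt0P; exists v; apply: (subsetP (bfs_leq Y v (leq0n _))); rewrite /= set11.
  by clear -cY Ym; lia.
have dis : [disjoint bfs Y v i & Y'].
  rewrite -setI_eq0; apply/eqP/setP=> u; rewrite in_setI in_set0 in_setD.
  by case: (boolP (u \in bfs Y v i)) => //= /(subsetP bb) ->.
have ac : anticomplete e (bfs Y v i) Y'.
  move=> x y xi; rewrite in_setD => /andP[yn yY]; apply: contraNN yn.
  exact: bfs_edge.
have aY : (alpha e (bfs Y v i) + alpha e Y' <= alpha e Y)%N.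
  apply: leq_trans (alphaU e_sym dis ac) (alphaS _ _).
  by rewrite subUset (subset_trans bb bY) subsetDl.
have c0 : 0 <= 2 * q * rho by rewrite !mulr_ge0.
apply: le_trans (_ : 2 * q * rho * (alpha e (bfs Y v i) + alpha e Y')%:R <= _); last first.
  by rewrite ler_wpM2l // ler_nat.
rewrite cY !natrD mulrDr; apply: lerD; last first.
  by apply: IHm => //; apply: subset_trans YX; apply: subsetDl.
apply: le_trans gi _; rewrite [2 * q * rho]mulrC -mulrA ler_wpM2l //.
by apply: bfs_alpha => // j ji; apply: Hlayer (leq_trans ji ir).
Qed.

End Decomposition.
End Layers.

Section Indices.
Local Open Scope nat_scope.

Lemma last_iota i n : last i (iota i.+1 n) = i + n.
Proof. by elim: n i => [|n IHn] i /=; rewrite ?addn0 // IHn addSnnS. Qed.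

Lemma mem_traject_predn i n j : n <= i -> j \in traject predn i.-1 n -> i - n <= j < i.
Proof.
elim: n i => // n IHn [//|i] ni /=; rewrite inE => /predU1P[->|/IHn H]; first by lia.
by have := H ni; lia.
Qed.

Lemma traject_predn_uniq i n : n <= i -> uniq (traject predn i.-1 n).
Proof.
elim: n i => // n IHn [//|i] ni /=; rewrite (IHn i ni) andbT.
by apply/negP => /(mem_traject_predn (ni : n <= i)); lia.
Qed.

Lemma last_traject_predn i n : n <= i -> last i (traject predn i.-1 n) = i - n.
Proof. by elim: n i => [|n IHn] [|i] //= ni; rewrite ?subn0 // IHn. Qed.

End Indices.

Section Colouring.
Local Open Scope nat_scope.
Variables (T : finType) (e : rel T).
Hypotheses (e_sym : symmetric e) (e_irr : irreflexive e).
Variables (Z : {set T}) (col : T -> bool) (l : nat).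
Hypothesis l_odd : odd l.
Hypothesis col_path : forall (x : T) (p : seq T),
  spath e Z (x :: p) -> size p = l -> col x = col (last x p).
Hypothesis degZ : forall x, x \in Z -> 2 < #|[set y in Z | e x y]|.

Section OnPath.
Variables (x0 : T) (P : seq T).
Hypothesis PZ : spath e Z P.
Let f := nth x0 P.
Let adj : rel nat := fun a b => e (f a) (f b).

Let adjS i : i.+1 < size P -> adj i i.+1.
Proof. by move=> iP; case/and3P: PZ => /(sortedP x0) eP _ _; apply: eP. Qed.

Let fZ i : i < size P -> f i \in Z.
Proof. by move=> iP; case/and3P: PZ => _ _ /allP; apply; rewrite mem_nth. Qed.

Let f_inj i j : i < size P -> j < size P -> f i = f j -> i = j.
Proof.
move=> iP jP /eqP; rewrite nth_uniq // => [/eqP//|]; by case/and3P: PZ.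
Qed.

Let path_up i n : i + n < size P -> path adj i (iota i.+1 n).
Proof.
elim: n i => //= n IHn i iP; rewrite adjS ?IHn //; lia.
Qed.

Let path_down i n : n <= i -> i < size P -> path adj i (traject predn i.-1 n).
Proof.
elim: n i => //= n IHn [//|i] ni iP; rewrite /= IHn ?(ltnW iP) // andbT.
by rewrite /adj e_sym; apply: adjS.
Qed.

Let col_idx i s : path adj i s -> uniq (i :: s) -> all (gtn (size P)) (i :: s) ->
  size s = l -> col (f i) = col (f (last i s)).
Proof.
move=> adj_s us /allP sP ss; rewrite -last_map; apply: col_path; last by rewrite size_map.
apply/and3P; split.
- by rewrite /= path_map.
- rewrite -[f i :: _]/(map f (i :: s)) map_inj_in_uniq // => a b /sP aP /sP bP.
  exact: f_inj.
- by rewrite -[f i :: _]/(map f (i :: s)) all_map; apply/allP => a /sP /fZ.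
Qed.

Let col_period i : i + l < size P -> col (f (i + l)) = col (f i).
Proof.
move=> iP; rewrite -(last_iota i l); apply/esym/col_idx; rewrite ?size_iota //.
- exact: path_up.
- by rewrite -[_ :: _]/(iota i l.+1) iota_uniq.
- by rewrite -[_ :: _]/(iota i l.+1); apply/allP => a; rewrite mem_iota inE; lia.
Qed.

(* Both neighbours of [i] on the path start an [l]-path through [i] and the chord
   [i j] with the same end. *)
Let col_chord i j s : 2 < l -> 0 < i -> i.+1 < size P -> adj i j -> path adj j s ->
  uniq (j :: s) -> all (gtn (size P)) (j :: s) -> size s = l - 2 ->
  {in j :: s, forall k, k < i.-1 \/ i.+1 < k} -> col (f i.-1) = col (f i.+1).
Proof.
move=> l2 i0 iP ij js us sP ss avoid.
have out k : i.-1 <= k <= i.+1 -> k \notin j :: s.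
  by move=> ki; apply/negP => /avoid; lia.
have E a : (a == i.-1) || (a == i.+1) -> col (f a) = col (f (last j s)).
  move=> ai; have aE : a = i.-1 \/ a = i.+1 by move: ai; lia.
  rewrite -[last j s]/(last a [:: i, j & s]); apply: col_idx.
  - rewrite /= ij js !andbT; case: aE => ->; last by rewrite /adj e_sym; apply: adjS.
    by rewrite -{2}(prednK i0); apply: adjS; lia.
  - rewrite -cat1s -[i :: _]/([:: i] ++ (j :: s)) catA cat_uniq us andbT.
    apply/andP; split; first by rewrite /= inE; lia.
    apply/hasPn => k ks; apply/negP; rewrite !inE => ka.
    by have := avoid k ks; lia.
  - by move: sP => /= /andP[-> ->]; lia.
  - by rewrite /= ss; lia.
by rewrite (E i.-1) ?eqxx // (E i.+1) ?eqxx ?orbT.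
Qed.

Let chord_up i j : 2 < l -> 0 < i -> i.+1 < size P -> adj i j ->
  j + (l - 2) < size P -> i.+1 < j \/ j + (l - 2) < i.-1 ->
  col (f i.-1) = col (f i.+1).
Proof.
move=> l2 i0 iP ij h1 h2.
have inup a : a \in j :: iota j.+1 (l - 2) -> j <= a <= j + (l - 2).
  by rewrite -[_ :: _]/(iota j (l - 2).+1) mem_iota; lia.
apply: (@col_chord i j (iota j.+1 (l - 2))); rewrite ?size_iota //.
- by apply: path_up.
- by rewrite -[_ :: _]/(iota j (l - 2).+1) iota_uniq.
- by apply/allP => a /inup; rewrite inE; clear -h1; lia.
- by move=> a /inup; clear -h2; lia.
Qed.

Let chord_down i j : 2 < l -> 0 < i -> i.+1 < size P -> adj i j ->
  j < size P -> l - 2 <= j -> j < i.-1 \/ i.+1 < j - (l - 2) ->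
  col (f i.-1) = col (f i.+1).
Proof.
move=> l2 i0 iP ij jP h1 h2.
have indn a : a \in j :: traject predn j.-1 (l - 2) -> j - (l - 2) <= a <= j.
  by rewrite inE => /predU1P[->|/(mem_traject_predn h1)]; clear; lia.
apply: (@col_chord i j (traject predn j.-1 (l - 2))); rewrite ?size_traject //.
- exact: path_down.
- rewrite cons_uniq traject_predn_uniq // andbT.
  by apply/negP => /(mem_traject_predn h1); clear; lia.
- by apply/allP => a /indn; rewrite inE; clear -jP; lia.
- by move=> a /indn; clear -h2; lia.
Qed.

Let col_leg i y : 0 < l -> l < i -> i + l < size P -> y \in Z -> e (f i) y ->
  y \notin P -> col (f i.-1) = col (f i.+1).
Proof.
move=> l0 li iP yZ ey yP.
have E s : path adj i s -> uniq (i :: s) -> all (gtn (size P)) (i :: s) ->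
    size s = l.-1 -> col y = col (f (last i s)).
  move=> adj_s us /allP sP ss; rewrite -last_map -[last _ _]/(last y (f i :: map f s)).
  apply: col_path; last by rewrite /= size_map ss prednK.
  have sub : {subset map f (i :: s) <= P}.
    by move=> _ /mapP[a /sP aP ->]; rewrite mem_nth.
  case/and3P: PZ => eP uP /allP ZP; apply/and3P; split.
  - by rewrite /= e_sym ey path_map.
  - rewrite -[f i :: _]/(map f (i :: s)) cons_uniq map_inj_in_uniq ?us ?andbT.
      by apply: contra yP => /sub.
    by move=> a b /sP aP /sP bP; apply: f_inj.
  - rewrite -[f i :: _]/(map f (i :: s)); apply/allP => a.
    by rewrite inE => /predU1P[->//|/sub/ZP].
have h1 : l.-1 <= i by clear -li; lia.
have inup a : a \in i :: iota i.+1 l.-1 -> a < size P.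
  by rewrite -[_ :: _]/(iota i l.-1.+1) mem_iota; clear -iP l0; lia.
have indn a : a \in i :: traject predn i.-1 l.-1 -> a < size P.
  by rewrite inE => /predU1P[->|/(mem_traject_predn h1)]; clear -iP; lia.
transitivity (col y).
  rewrite (E (iota i.+1 l.-1)) ?size_iota // ?last_iota.
  - have -> : i + l.-1 = i.-1 + l by clear -l0 li; lia.
    by rewrite col_period //; clear -iP; lia.
  - by apply: path_up; clear -iP; lia.
  - by rewrite -[_ :: _]/(iota i l.-1.+1) iota_uniq.
  - exact/allP.
rewrite (E (traject predn i.-1 l.-1)) ?size_traject // ?last_traject_predn //.
- have -> : i.+1 = i - l.-1 + l by clear -l0 li; lia.
  by rewrite col_period //; clear -iP li; lia.
- by apply: path_down => //; clear -iP; lia.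
- rewrite cons_uniq traject_predn_uniq ?andbT //.
  by apply/negP => /(mem_traject_predn h1); clear -l0; lia.
- exact/allP.
Qed.

Let col_step i : 2 * l <= i -> i + 2 * l < size P -> col (f i.-1) = col (f i.+1).
Proof.
have l0 : 0 < l by case: (l) l_odd.
move=> li iP; have i0 : 0 < i by lia.
have [l1|l2] : l = 1 \/ 2 < l by move: l_odd l0; lia.
  have := @col_period i.-1; have := @col_period i; rewrite l1 !addn1 (prednK i0).
  by move=> <-; [move=> <- //|]; lia.
have ilt : i < size P by lia.
have /subsetPn[y] : ~~ ([set y in Z | e (f i) y] \subset [set f i.-1; f i.+1]).
  apply/negP => /subset_leq_card; have := degZ (fZ ilt); rewrite cards2; lia.
rewrite !inE negb_or => /andP[yZ ey] /andP[yp yn].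
have [yP|yP] := boolP (y \in P); last first.
  by apply: (col_leg l0 _ _ yZ ey yP); clear -li iP l0; lia.
have [j jP yE] : exists2 j, j < size P & y = f j.
  by exists (index y P); rewrite ?index_mem // /f nth_index.
have ij : adj i j by rewrite /adj -yE.
have ji : j <> i by move=> E; move: ij; rewrite /adj E e_irr.
have jp : j <> i.-1 by move=> E; rewrite yE E eqxx in yp.
have jn : j <> i.+1 by move=> E; rewrite yE E eqxx in yn.
clear -l2 i0 ilt ij ji jp jn jP li iP chord_up chord_down.
have iSP : i.+1 < size P by lia.
have [jlt|jgt] := ltnP j i.
  have [h|h] := ltnP (j + (l - 2)) i.-1; first by apply: (chord_up l2 i0 iSP ij); lia.
  by apply: (chord_down l2 i0 iSP ij); lia.
have [h|h] := ltnP i.+1 (j - (l - 2)); first by apply: (chord_down l2 i0 iSP ij); lia.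
by apply: (chord_up l2 i0 iSP ij); lia.
Qed.

(* Colours have period 2 in the middle of the path and odd period [l] on all of it. *)
Lemma col_path_const : 6 * l < size P -> {in P &, forall x y, col x = col y}.
Proof.
move=> lP; have l0 : 0 < l by case: (l) l_odd.
have shift2 k i : 2 * l <= i.+1 -> i + 2 * k <= 4 * l -> col (f (i + 2 * k)) = col (f i).
  elim: k => [|k IHk] li ik; first by rewrite muln0 addn0.
  rewrite -IHk //; last by clear -ik; lia.
  have -> : i + 2 * k.+1 = (i + 2 * k).+1.+1 by clear; lia.
  by have := @col_step (i + 2 * k).+1; move=> <- //; clear -li ik lP l0; lia.
have mid i : 2 * l <= i <= 4 * l -> col (f i) = col (f (2 * l)).
  move=> il; have [k [Ek|Ek]] : exists k, i = 2 * l + 2 * k \/ i = 2 * l - 1 + 2 * k.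
  - by exists ((i.+1 - 2 * l)./2); clear -il l0; lia.
  - by rewrite Ek shift2 //; clear -il Ek; lia.
  have [m El] : exists m, 3 * l = 2 * l - 1 + 2 * m.
    by exists (l.+1)./2; move: l_odd; clear; lia.
  rewrite Ek shift2; [|clear; lia|clear -il Ek; lia].
  rewrite -(shift2 m); [|clear; lia|clear -El; lia].
  rewrite -El; have -> : 3 * l = 2 * l + l by clear; lia.
  by rewrite col_period //; clear -lP; lia.
have all_eq i : i < size P -> col (f i) = col (f (2 * l)).
  elim/ltn_ind: i => i IHi iP.
  have [il|li] := ltnP i (2 * l).
    rewrite -(mid (i + l + l)); last by clear -il; lia.
    by rewrite !col_period //; clear -il lP; lia.
  have [il|il] := leqP i (4 * l); first by apply: mid; rewrite li.
  have Ei : i = i - l + l by clear -li; lia.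
  by rewrite Ei col_period ?IHi -?Ei //; clear -li il l0 iP; lia.
by move=> x y xP yP; rewrite -(nth_index x0 xP) -(nth_index x0 yP) !all_eq // index_mem.
Qed.

End OnPath.

Hypothesis Z_connected : forall X Y : {set T}, X != set0 -> Y != set0 ->
  [disjoint X & Y] -> X :|: Y = Z -> ~ anticomplete e X Y.

Lemma col_const (P : seq T) : spath e Z P -> 12 * l < size P -> {in Z &, forall x y, col x = col y}.
Proof.
move=> PZ lP; have [p0 p0P] : exists p0, p0 \in P.
  by case: P PZ lP => [|p0 p] //; exists p0; rewrite mem_head.
have sub6 : 6 * l < size P by clear -lP; lia.
have p0Z : p0 \in Z by case/and3P: PZ => _ _ /allP; apply.
suff H z : z \in Z -> col z = col p0 by move=> x y /H-> /H->.
move=> zZ; pose e' := [rel x y | [&& x \in Z, y \in Z & e x y]].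
have : connect e' z p0.
  apply: contraT => nz; pose X := [set u in Z | connect e' z u].
  case: (@Z_connected X (Z :\: X)).
  - by apply/set0Pn; exists z; rewrite inE zZ connect0.
  - by apply/set0Pn; exists p0; rewrite !inE p0Z (negPf nz).
  - rewrite -setI_eq0; apply/eqP/setP=> u; rewrite !inE.
    by case: (u \in Z); case: connect.
  - by apply/setP=> u; rewrite !inE; case: (u \in Z); case: connect.
  - move=> x y; rewrite !inE => /andP[xZ zx] /andP[yn yZ]; apply: contraNN yn => exy.
    by rewrite yZ (connect_trans zx) // connect1 //= xZ yZ.
case/connectP=> q0 eq0 Ep0; case: (shortenP eq0) Ep0 => q eq uq _ Ep0 {q0 eq0}.
have [zP|zP] := boolP (z \in P); first exact: (col_path_const p0 PZ sub6).
have : has [in P] q.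
  apply/hasP; exists p0 => //; case: (q) Ep0 => [E|a s ->]; last exact: (mem_last a s).
  by move: zP; rewrite -[z]/(last z [::]) -E p0P.
move=> hq; move: eq uq Ep0; case: (split_find hq) => x s1 s2 xP s1P eq uq Ep0.
move: eq; rewrite cat_path => /andP[es1 _].
move: uq; rewrite -cat_cons cat_uniq => /and3P[us1 _ _].
have es1' : path e z (rcons s1 x) by apply: sub_path es1 => a b /and3P[].
have s1Z : all [in Z] (z :: rcons s1 x).
  rewrite /= zZ; elim: (rcons s1 x) (z) es1 => //= a s IHs b /andP[/and3P[_ aZ _] /IHs].
  by rewrite aZ.
rewrite (col_path_const p0 PZ sub6 p0P xP).
suff ext t : path e x t -> uniq (x :: t) -> {subset x :: t <= P} -> 6 * l <= size t ->
    col z = col x.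
  case/splitPr: xP => p1 p2 in PZ lP s1P ext *; case/and3P: (PZ) => eP uP _.
  move: uP; rewrite cat_uniq => /and3P[up1 np1 up2].
  have [h|h] := leqP (6 * l) (size p2).
    apply: ext h => //; first by case/cat_sorted2: eP.
    by move=> y yp; rewrite mem_cat yp orbT.
  apply: (ext (rev p1)).
  - have /cat_sorted2[] : sorted e ((p1 ++ [:: x]) ++ p2) by rewrite -catA.
    rewrite -rev_sorted rev_cat /= => e1 _; apply: sub_path e1 => a b.
    by rewrite e_sym.
  - rewrite /= rev_uniq up1 mem_rev andbT; apply/negP => xp1.
    by case/hasP: np1; exists x; rewrite ?mem_head.
  - move=> y; rewrite inE mem_rev mem_cat inE => /orP[->|->] //; by rewrite orbT.
  - by move: lP h; rewrite size_rev size_cat /=; move: (size p1) (size p2) => a b; clear; lia.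
move=> ext ut tP lt; apply: (@col_path_const p0 (z :: rcons s1 x ++ t)).
- apply/and3P; split.
  + by rewrite /= cat_path es1' last_rcons.
  + move: ut; rewrite cons_uniq => /andP[xt ut]; rewrite -cat_cons cat_uniq us1 ut andbT /=.
    apply/hasPn => y yt; rewrite inE mem_rcons inE !negb_or.
    have yP : y \in P by apply: tP; rewrite inE yt orbT.
    apply/and3P; split.
    * by apply: contraNneq zP => <-.
    * by apply: contraNneq xt => <-.
    * by apply: contraNN s1P => ys1; apply/hasP; exists y.
  + rewrite -cat_cons all_cat s1Z; apply/allP => y yt; case/and3P: PZ => _ _ /allP; apply.
    by apply: tP; rewrite inE yt orbT.
- by rewrite /= size_cat size_rcons; clear -lt; lia.
- exact: mem_head.
- by rewrite inE mem_cat mem_rcons mem_head orbT.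
Qed.

End Colouring.

Section LayerCycles.
Local Open Scope nat_scope.
Variables (T : finType) (e : rel T).
Hypotheses (e_sym : symmetric e) (e_irr : irreflexive e).
Variables (Y : {set T}) (v : T) (j : nat).

Definition parent u := odflt u
  [pick w | e u w && [exists i : 'I_j, (u \in layer e Y v i.+1) && (w \in layer e Y v i)]].

Lemma parentP i u : i < j -> u \in layer e Y v i.+1 ->
  parent u \in layer e Y v i /\ e u (parent u).
Proof.
move=> ij ui; rewrite /parent; case: pickP => [w /andP[euw /existsP[k /andP[uk wk]]]|none] /=.
  by have [->] := layer_inj ui uk.
have [w wi euw] := layer_parent e_sym ui.
have /negP[] := none w; rewrite euw /=; apply/existsP; exists (Ordinal ij).
by rewrite ui.
Qed.

Lemma iter_parent t u : t <= j -> u \in layer e Y v j ->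
  iter t parent u \in layer e Y v (j - t).
Proof.
elim: t => [|t IHt] tj uj; first by rewrite subn0.
have Ej : j - t = (j - t.+1).+1 by clear -tj; lia.
have := IHt (ltnW tj) uj; rewrite Ej => /parentP[]//.
by clear -tj; lia.
Qed.

Lemma iter_parent_path t u : t <= j -> u \in layer e Y v j ->
  path e u (traject parent (parent u) t).
Proof.
move=> tj uj; elim: t => // t IHt in tj *.
rewrite trajectSr rcons_path IHt ?(ltnW tj) // last_traject /= -iterSr /=.
have := iter_parent (ltnW tj) uj.
have -> : j - t = (j - t.+1).+1 by clear -tj; lia.
by case/parentP=> //; clear -tj; lia.
Qed.

Lemma iter_parent_inj s t x y : s <= j -> t <= j ->
  x \in layer e Y v j -> y \in layer e Y v j ->
  iter s parent x = iter t parent y -> s = t.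
Proof.
move=> sj tj xj yj E; have := iter_parent sj xj; rewrite E.
by move/(layer_inj (iter_parent tj yj)); clear -sj tj; lia.
Qed.

Lemma traject_parent_uniq t u : t <= j -> u \in layer e Y v j ->
  uniq (traject parent u t.+1).
Proof.
move=> tj uj; elim: t tj => // t IHt tj.
rewrite trajectSr rcons_uniq IHt ?(ltnW tj) // andbT.
apply/negP => /trajectP[s st] E.
by move: (st); rewrite -(iter_parent_inj tj _ uj uj E) ?ltnn // ltnW // (leq_trans st).
Qed.

(* The cycle climbs [J] parents from the end of [p], then descends to [x]. *)
Lemma close_path J x (p : seq T) :
  {subset x :: p <= layer e Y v j} -> path e x p -> uniq (x :: p) ->
  0 < size p -> 0 < J <= j ->
  iter J parent x = iter J parent (last x p) ->
  iter J.-1 parent x <> iter J.-1 parent (last x p) ->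
  has_cycle e (size p + 2 * J).
Proof.
case: J => // J sub ep up p0 Jj EJ NJ; set y := last x p.
have xj : x \in layer e Y v j by apply: sub; rewrite mem_head.
have yj : y \in layer e Y v j by apply: sub; apply: mem_last.
pose c := (x :: p) ++ traject parent (parent y) J.+1 ++ rev (traject parent (parent x) J).
have sc : size c == size p + 2 * J.+1.
  by rewrite /c !size_cat size_rev !size_traject /=; apply/eqP; clear; lia.
apply/andP; split; first by move: (size p) p0 => n; clear; lia.
apply/existsP; exists (Tuple sc); apply/andP; split.
  change (path e x (rcons (p ++ (traject parent (parent y) J.+1
    ++ rev (traject parent (parent x) J))) x)).
  rewrite rcons_cat cat_path ep rcons_cat -/y andTb.
  have Ely : last y (traject parent (parent y) J.+1) = iter J.+1 parent y.
    by rewrite last_traject.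
  have Elx : rcons (rev (traject parent (parent x) J)) x =
      rev (belast x (traject parent (parent x) J.+1)).
    by rewrite -rev_cons trajectSr belast_rcons.
  rewrite cat_path iter_parent_path // Ely Elx -EJ andTb.
  rewrite -(last_traject parent x J.+1) (eq_path (e' := fun a b => e b a)); last first.
    by move=> a b; rewrite e_sym.
  by rewrite rev_path; apply: iter_parent_path.
have lev u i t : u \in layer e Y v j -> i < t -> t <= j -> iter i.+1 parent u \notin layer e Y v j.
  move=> uj it tj; apply/negP => /layer_inj -/(_ _ (iter_parent (leq_trans it tj) uj)).
  by clear -it tj; lia.
change (uniq c); rewrite /c cat_uniq up andTb; apply/andP; split.
  apply/hasPn => z; rewrite mem_cat mem_rev => zt; apply/negP => /sub; apply/negP.
  case/orP: zt => /trajectP[i iJ ->]; rewrite -iterSr; apply: lev Jj => //.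
  exact: ltnW.
rewrite cat_uniq rev_uniq.
have := traject_parent_uniq Jj yj; rewrite trajectS cons_uniq => /andP[_ ->].
have := traject_parent_uniq (ltnW Jj) xj; rewrite trajectS cons_uniq => /andP[_ ->].
rewrite andbT andTb; apply/hasPn => z; rewrite mem_rev => /trajectP[i iJ ->].
apply/negP => /trajectP[k kJ]; rewrite -!iterSr => E.
have Eik : i.+1 = k.+1 by apply: iter_parent_inj E => //; apply: leq_trans Jj => //; apply: ltnW.
apply: NJ; rewrite -(subnK iJ) !iterD; congr (iter _ _ _).
by rewrite E Eik.
Qed.

Variables (R : realFieldType) (q : R) (Z : {set T}).
Hypotheses (Zj : Z \subset layer e Y v j) (Zcrit : critical e q Z) (q4 : (4 <= q)%R).

Lemma critical_degree x : x \in Z -> 2 < #|[set y in Z | e x y]|.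
Proof.
move=> xZ; have xsub : [set x] \subset Z by rewrite sub1set.
have := critical_expansion e_sym Zcrit xsub.
have a1 : (1 <= (alpha e [set x])%:R :> R)%R.
  by rewrite (ler_nat _ 1) alpha_gt0 // -card_gt0 cards1.
have sub : ([set x] :|: nbh e [set x]) :&: Z \subset x |: [set y in Z | e x y].
  apply/subsetP=> y; rewrite !inE => /andP[/orP[->//|/exists_inP[z /set1P-> ->]] ->].
  by rewrite orbT.
move=> h; have : (4%:R <= #|([set x] :|: nbh e [set x]) :&: Z|%:R :> R)%R.
  apply: le_trans h; apply: le_trans (_ : q * 1 <= _)%R; first by rewrite mulr1.
  by rewrite ler_pM2l // (lt_le_trans _ q4).
rewrite ler_nat => /leq_trans/(_ (subset_leq_card sub)).
by rewrite cardsU1; case: (_ \notin _); clear; lia.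
Qed.

Lemma critical_cycles M (P : seq T) : spath e Z P -> 12 * M < size P ->
  exists2 J, 0 < J <= j & forall l, odd l -> l <= M -> has_cycle e (l + 2 * J).
Proof.
move=> PZ MP; have [Z0 _ _] := Zcrit; have [z zZ] := set0Pn _ Z0.
have Zlayer x : x \in Z -> x \in layer e Y v j by apply: subsetP.
pose same t := [forall x in Z, forall y in Z, iter t parent x == iter t parent y].
have sameP t : reflect {in Z &, forall x y, iter t parent x = iter t parent y} (same t).
  apply: (iffP forall_inP) => [H x y xZ yZ|H x xZ]; first exact/eqP/(forall_inP (H x xZ)).
  by apply/forall_inP => y yZ; apply/eqP/H.
have ex_same : exists t, same t.
  exists j; apply/sameP => x y /Zlayer xj /Zlayer yj.
  have := iter_parent (leqnn j) xj; have := iter_parent (leqnn j) yj.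
  by rewrite subnn => /set1P-> /set1P->.
case: (ex_minnP ex_same) => J /sameP sJ Jmin.
have Jj : J <= j.
  apply: Jmin; apply/sameP => x y /Zlayer xj /Zlayer yj.
  have := iter_parent (leqnn j) xj; have := iter_parent (leqnn j) yj.
  by rewrite subnn => /set1P-> /set1P->.
have [J0|J0] := posnP J.
  have : #|Z| <= #|[set z]|.
    by apply/subset_leq_card/subsetP => y yZ; rewrite inE; apply/eqP; move: sJ; rewrite J0; apply.
  have : #|[set y in Z | e z y]| <= #|Z|.
    by apply/subset_leq_card/subsetP => y; rewrite inE => /andP[].
  by have := critical_degree zZ; rewrite cards1; clear; lia.
exists J; first by rewrite J0.
move=> l l_odd lM; apply: contraT => nocycle.
pose col u := iter J.-1 parent u == iter J.-1 parent z.
have : same J.-1.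
  apply/sameP; suff H x : x \in Z -> col x.
    by move=> x y /H/eqP-> /H/eqP->.
  move=> xZ; suff -> : col x = col z by apply: eqxx.
  apply: (col_const e_sym e_irr l_odd _ critical_degree _ PZ) => //.
  - move=> {x xZ} x p /and3P[exp uxp /allP xpZ] sp.
    have [E|N] := eqVneq (iter J.-1 parent x) (iter J.-1 parent (last x p)).
      by rewrite /col E.
    case/negP: nocycle; rewrite -sp; apply: close_path => //.
    + by move=> u /xpZ/Zlayer.
    + exact: exp.
    + exact: uxp.
    + by rewrite sp; case: (l) l_odd.
    + by rewrite J0.
    + by apply: sJ; apply: xpZ; rewrite ?mem_head ?mem_last.
    + exact/eqP.
  - by move=> X X' X0 X'0 dX XX'; apply: critical_connected Zcrit X0 X'0 dX XX'.
  - by apply: leq_ltn_trans MP; rewrite leq_mul2l.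
by move/Jmin; move: J0; clear; lia.
Qed.

End LayerCycles.

Section DenseSets.
Variables (T : finType) (e : rel T).
Hypotheses (e_sym : symmetric e) (e_irr : irreflexive e).
Variable R : realFieldType.

Lemma dense_cycles (q rho : R) (r s M : nat) (X : {set T}) :
  4 <= q -> 1 <= rho -> #|X|%:R < rho ^+ r.+1 ->
  2 * q * rho * (alpha e X)%:R < #|X|%:R ->
  (forall F : {set T}, F \subset X -> F != set0 -> (#|F| <= s)%N ->
     #|F|%:R < q * (alpha e F)%:R) ->
  (forall F : {set T}, F \subset X -> #|F| = s -> (12 * M + s)%:R < q * (alpha e F)%:R) ->
  exists2 J, (0 < J <= r)%N & forall l, odd l -> (l <= M)%N -> has_cycle e (l + 2 * J).
Proof.
move=> q4 rho1 Xr Xdense expand_le expand_s.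
pose bad := [exists Y : {set T}, exists v, exists j : 'I_r.+1,
  [&& Y \subset X, v \in Y & q * (alpha e (layer e Y v j))%:R < #|layer e Y v j|%:R]].
have q0 : 0 <= q by apply: le_trans q4.
have /existsP[Y /existsP[v /existsP[j /and3P[YX vY Njq]]]] : bad.
  apply: contraLR Xdense => /existsPn nobad; rewrite -leNgt.
  apply: (bfs_decomposition e_sym q0 rho1 Xr) => Y v j YX vY jr.
  have /existsPn/(_ v)/existsPn/(_ (Ordinal (jr : (j < r.+1)%N))) := nobad Y.
  by rewrite YX vY /= -leNgt.
have N0 : layer e Y v j != set0.
  by apply: contraTneq Njq => ->; rewrite cards0 -leNgt mulr_ge0.
have [Z ZN Zcrit] := exists_critical N0 (ltW Njq).
have ZX : Z \subset X.
  by apply: subset_trans ZN (subset_trans _ YX); apply: layer_sub.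
have [Z0 qZ _] := Zcrit.
have sZ : (s <= #|Z|)%N.
  rewrite leqNgt; apply/negP => /ltnW /(expand_le _ ZX Z0).
  by rewrite ltNge qZ.
have [F [p [FZ Fs pZ pF]]] := dfs_path e_sym sZ.
have pM : (12 * M < size p)%N.
  rewrite -(ltn_add2r s) -(ltr_nat R).
  apply: lt_le_trans (expand_s _ (subset_trans FZ ZX) Fs) _.
  apply: le_trans (critical_expansion e_sym Zcrit FZ) _; rewrite ler_nat.
  exact: leq_trans pF _.
have [J /andP[J0 Jj] HJ] := critical_cycles e_sym e_irr ZN Zcrit q4 pZ pM.
by exists J => //; rewrite J0 (leq_trans Jj) // -ltnS.
Qed.

End DenseSets.
From mathcomp Require Import all_classical all_reals all_analysis.

Section LogStar.
Variable R : realType.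
Implicit Types x y : R.

Lemma logstar_le x y : x <= y -> (logstar x <= logstar y)%N.
Proof.
rewrite {2}/logstar; case: ex_minnP => k yk _ xy.
rewrite /logstar; case: ex_minnP => m _ min_m.
rewrite leqNgt; apply/negP => km.
have ge1 i : (i <= k)%N -> 1 <= iter i (@ln R) x.
  by move=> ik; rewrite leNgt; apply/negP => /min_m; rewrite leqNgt (leq_ltn_trans ik).
suff H i : (i <= k)%N -> iter i (@ln R) x <= iter i (@ln R) y.
  by have := lt_le_trans (le_lt_trans (H k (leqnn k)) yk) (ge1 k (leqnn k)); rewrite ltxx.
elim: i => // i IHi ik; rewrite !iterS ler_ln ?posrE.
- exact/IHi/ltnW.
- by apply: lt_le_trans (ge1 _ (ltnW ik)).
- by apply: lt_le_trans (le_trans (ge1 _ (ltnW ik)) (IHi (ltnW ik))).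
Qed.

Lemma logstar_ln x : 1 <= x -> logstar x = (logstar (ln x)).+1.
Proof.
move=> x1; rewrite /logstar; case: ex_minnP => [[|k]]; first by rewrite /= ltNge x1.
rewrite iterSr => xk mink; case: ex_minnP => m xm minm; congr S.
apply/eqP; rewrite eqn_leq minm // andbT -ltnS mink //.
by rewrite iterSr.
Qed.

Lemma ln2_bounds : 1 / 2 <= ln (2 : R) <= 1.
Proof.
apply/andP; split; last first.
  by have := @le_ln1Dx R 1; rewrite -[1 + 1]/(2%:R); apply; lra.
have := @le_ln1Dx R (- (1 / 2)); have -> : 1 + - (1 / 2) = 2^-1 :> R by field.
by rewrite lnV ?posrE //; lra.
Qed.

Lemma ln_nat_pow2 (x : R) n : x <= 2 ^+ n -> ln x <= n%:R.
Proof.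
have [/ln0 ->|x0 xn] := leP x 0; first by rewrite ler0n.
apply: le_trans (_ : ln (2 ^+ n) <= _); first by rewrite ler_ln ?posrE // exprn_gt0.
rewrite lnXn // -[ln 2 *+ n]mulr_natr ler_piMl //.
by have /andP[] := ln2_bounds.
Qed.

End LogStar.

Section Harmonic.
Variables (R : realType) (T : finType) (e : rel T).

Lemma has_cycle_card t : has_cycle e t -> (t <= #|T|)%N.
Proof.
case/andP=> _ /existsP[c /andP[_ uc]].
by rewrite -(size_tuple c) -(card_uniqP uc) max_card.
Qed.

Lemma Lodd_ge0 : 0 <= Lodd R e.
Proof. by apply: sumr_ge0 => t _; rewrite invr_ge0. Qed.

Lemma Lodd_ge_sum n : \sum_(0 <= t < n | odd_cycle_length e t) (t%:R)^-1 <= Lodd R e.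
Proof.
rewrite /Lodd -(big_mkord (odd_cycle_length e) (fun t => (t%:R)^-1 : R)).
rewrite ![in leRHS]big_mkcond [leLHS]big_mkcond /=.
have F0 t : 0 <= (if odd t && has_cycle e t then (t%:R)^-1 else 0 : R).
  by case: ifP => // _; rewrite invr_ge0.
have [le|lt] := leqP n #|T|.+1.
  rewrite [leRHS](big_cat_nat (leq0n n) le) /= lerDl.
  by apply: sumr_ge0 => t _; apply: F0.
rewrite [leLHS](big_cat_nat (leq0n _) (ltnW lt)) /= gerDl big_nat_cond big1 //.
move=> t /andP[/andP[Tt _] _].
case: ifP => // /andP[_ /has_cycle_card]; by rewrite leqNgt Tt.
Qed.

Lemma Lodd_ge_interval a m : (0 < a)%N ->
  (forall i, (i < m)%N -> has_cycle e (2 * a + 1 + 2 * i)) ->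
  1 / 2 * ln ((2 * a + 1 + 2 * m)%:R / (2 * a + 1)%:R) <= Lodd R e.
Proof.
move=> a0 cyc; apply: le_trans (Lodd_ge_sum (2 * a + 1 + 2 * m)%N).
rewrite ln_div ?posrE ?ltr0n; try lia.
elim: m cyc => [|m IHm] cyc.
  by rewrite muln0 addn0 subrr mulr0 sumr_ge0 // => t _; rewrite invr_ge0.
have {}IHm := IHm (fun i im => cyc i (ltnW im)).
set x := (2 * a + 1 + 2 * m)%N in IHm *.
have -> : (2 * a + 1 + 2 * m.+1 = x.+2)%N by rewrite /x; lia.
have xP : odd_cycle_length e x.
  by apply/andP; split; [rewrite /x; lia | apply: cyc].
have x0 : 0 < x%:R :> R by rewrite ltr0n /x; lia.
have recr N : \sum_(0 <= t < N.+1 | odd_cycle_length e t) (t%:R)^-1 =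
    \sum_(0 <= t < N | odd_cycle_length e t) (t%:R)^-1 +
    (if odd_cycle_length e N then (N%:R)^-1 else 0) :> R.
  by rewrite big_mkcond big_nat_recr // -big_mkcond.
have last_ge0 : 0 <= (if odd_cycle_length e x.+1 then (x.+1%:R)^-1 else 0 : R).
  by case: ifP => // _; rewrite invr_ge0.
rewrite !recr (_ : (if odd_cycle_length e x then _ else _) = (x%:R)^-1); last by rewrite xP.
have step : ln (x.+2%:R : R) - ln x%:R <= 2 * (x%:R)^-1.
  rewrite -ln_div ?posrE ?x0 ?ltr0n //.
  have -> : x.+2%:R / x%:R = 1 + 2 * (x%:R)^-1 :> R.
    by rewrite -addn2 natrD; field; rewrite gt_eqF.
  apply: le_ln1Dx; apply: lt_trans (_ : 0 < _); first by lra.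
  by rewrite mulr_gt0 // invr_gt0.
rewrite -addrA; apply: le_trans (lerD IHm (_ : (x%:R)^-1 <= _)); last by rewrite lerDl.
rewrite -lerBlDl; apply: le_trans (_ : 1 / 2 * (2 * (x%:R)^-1) <= _); last first.
  by rewrite mulrA divfK ?mul1r.
apply: le_trans (_ : 1 / 2 * (ln (x.+2%:R : R) - ln x%:R) <= _); last by rewrite ler_pM2l //; lra.
by rewrite -mulrBr opprB addrA subrK.
Qed.

End Harmonic.

Lemma ltn_expn12_exp2 k : (224 <= k)%N -> ((60 * k) ^ 12 < 2 ^ k)%N.
Proof.
move=> k224; pose a := (k %/ 32)%N.
have k_ub : (60 * k < 2 ^ (11 + a))%N.
  rewrite expnD; have := ltn_expl a (isT : (1 < 2)%N).
  have := ltn_ceil k (isT : (0 < 32)%N); rewrite -/a.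
  by rewrite (_ : (2 ^ 11 = 2048)%N) //; lia.
apply: leq_trans (_ : 2 ^ ((11 + a) * 12) <= _)%N; first by rewrite expnM ltn_exp2r.
by rewrite leq_exp2l //; have := leq_trunc_div k 32; rewrite -/a; lia.
Qed.

Section Dichotomy.
Variables (R : realType) (T : finType) (e : rel T).
Hypotheses (e_sym : symmetric e) (e_irr : irreflexive e).
Implicit Types (X S F : {set T}) (i : R).

Let alphaR_ge1 F : F != finset.set0 -> 1 <= (alpha e F)%:R :> R.
Proof. by move=> F0; rewrite (ler_nat _ 1) alpha_gt0. Qed.

Lemma small_dense_subset X i : X != finset.set0 -> 20 <= i ->
  i * (alpha e X)%:R <= #|X|%:R ->
  1 / 2 * ln i <= Lodd R e \/
  exists S, [/\ S \subset X, S != finset.set0, #|S|%:R <= 40 * i * ln (#|X|%:R : R) &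
    i / 20 * (alpha e S)%:R <= #|S|%:R].
Proof.
move=> X0 i20 iX; have a1 := alphaR_ge1 X0.
have i0 : 0 <= i by apply: le_trans i20.
set n := #|X| in iX *; have n20 : 20 <= n%:R :> R.
  by apply: le_trans i20 (le_trans _ iX); rewrite ler_peMr.
have n0 : (0 < n)%N by rewrite -(ltr_nat R); apply: lt_le_trans n20.
pose r := trunc_log 2 n; pose m := (Num.truncn (i * r.+1%:R)).+1.
have /andP[rn nr] : (2 ^ r <= n < 2 ^ r.+1)%N by apply: trunc_log_bounds.
have /andP[ln2l ln2u] := ln2_bounds R.
have [/existsP[S /and4P[SX S0 Sm iS]]|none] := boolP [exists S : {set T},
    [&& S \subset X, S != finset.set0, (#|S| <= 8 * m)%N &
        i / 20 * (alpha e S)%:R <= #|S|%:R]]; [right|left].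
  exists S; split=> //.
  apply: (@le_trans _ _ (8 * m)%:R); first by rewrite ler_nat.
  have r_ub : r%:R <= 2 * ln (n%:R : R).
    have : ln ((2 : R) ^+ r) <= ln n%:R.
      by rewrite ler_ln ?posrE ?exprn_gt0 ?ltr0n // -natrX ler_nat.
    rewrite lnXn // -[ln 2 *+ r]mulr_natr.
    have : r%:R * (1 / 2) <= r%:R * ln (2 : R) by rewrite ler_wpM2l.
    by rewrite [ln 2 * _]mulrC; lra.
  have ln_n1 : 1 <= ln (n%:R : R).
    apply: le_trans (_ : ln (2 ^+ 2) <= _); first by rewrite lnXn // mulr2n; lra.
    by rewrite ler_ln ?posrE ?exprn_gt0 ?ltr0n //; lra.
  have m_ub : m%:R <= i * r.+1%:R + 1.
    by rewrite /m -[leLHS]natr1 lerD2r truncn_le mulr_ge0.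
  rewrite natrM; apply: le_trans (_ : 8 * (i * r.+1%:R + 1) <= _); first by rewrite ler_wpM2l.
  have : i * r.+1%:R <= i * (2 * ln (n%:R : R) + 1).
    by rewrite ler_wpM2l ?lerD -?natr1 ?lerD2r //; lra.
  have : 1 * 1 <= i * ln (n%:R : R) by rewrite ler_pM //; lra.
  have : i * 1 <= i * ln (n%:R : R) by rewrite ler_wpM2l //; lra.
  by rewrite mulrDr !mulr1 !mulrA [i * 2]mulrC; lra.
have expand F : F \subset X -> F != finset.set0 -> (#|F| <= 8 * m)%N ->
    #|F|%:R < i / 20 * (alpha e F)%:R.
  move=> FX F0 Fm; rewrite ltNge; apply/negP => iF; have /existsPn/(_ F) := none.
  by rewrite FX F0 Fm iF.
have [] := @dense_cycles _ e e_sym e_irr R (i / 5) 2 r (8 * m) (2 * m) X.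
- by lra.
- by lra.
- by rewrite -natrX ltr_nat.
- apply: lt_le_trans iX; rewrite ltr_pM2r; [lra|lra].
- move=> F FX F0 /(expand F FX F0) h; apply: lt_le_trans h _.
  by rewrite ler_wpM2r //; lra.
- move=> F FX Fm; have F0 : F != finset.set0 by rewrite -card_gt0 Fm muln_gt0.
  have := expand F FX F0; rewrite Fm => /(_ (leqnn _)) h.
  have -> : (12 * (2 * m) + 8 * m = 4 * (8 * m))%N by clear; lia.
  rewrite natrM; apply: lt_le_trans (_ : 4 * (i / 20 * (alpha e F)%:R) <= _).
    by rewrite ltr_pM2l.
  by rewrite mulrA; apply: ler_wpM2r => //; lra.
move=> J /andP[J0 Jr] cyc.
apply: le_trans (_ : 1 / 2 * ln ((2 * J + 1 + 2 * m)%:R / (2 * J + 1)%:R) <= _); last first.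
  apply: Lodd_ge_interval => // k km.
  have -> : (2 * J + 1 + 2 * k = (2 * k + 1) + 2 * J)%N by clear; lia.
  by apply: cyc; clear -km; lia.
rewrite ler_pM2l; last by lra.
have J1 : 0 < (2 * J + 1)%:R :> R by rewrite ltr0n addn1.
rewrite ler_ln ?posrE ?divr_gt0 ?ltr0n ?ler_pdivlMr ?addn1 //; last by apply: lt_le_trans i20.
rewrite -addn1.
have m_lb : i * r.+1%:R <= m%:R by apply/ltW/truncnS_gt.
apply: le_trans (_ : i * (2 * r.+1%:R) <= _).
  by rewrite ler_wpM2l // -natrM ler_nat; clear -Jr; lia.
rewrite mulrCA; apply: le_trans (_ : 2 * m%:R <= _); first by rewrite ler_pM2l.
by rewrite -natrM ler_nat; clear; lia.
Qed.

Lemma polynomial_size_cycles X i k : X != finset.set0 -> 2 ^+ 28 <= i ->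
  i * (alpha e X)%:R <= #|X|%:R -> #|X|%:R <= i ^+ 6 ->
  (16 <= k)%N -> 120 * k%:R <= i -> has_cycle e (2 * k + 1).
Proof.
move=> X0 i28 iX Xi k16 ki; have a1 := alphaR_ge1 X0.
have i1 : 1 <= i by apply: le_trans i28; rewrite exprn_ege1 // ler1n.
have i0 : 0 < i by lra.
have k0 : 0 < k%:R :> R by rewrite ltr0n; clear -k16; lia.
have k1 : 16 <= k%:R :> R by rewrite (ler_nat _ 16).
pose rho : R := i / (60 * k%:R).
have rho2 : 2 <= rho by rewrite ler_pdivlMr ?mulr_gt0 //; lra.
have rhoX : i ^+ 6 < rho ^+ k.+1.
  have [ki2|ik2] := leP ((60 * k%:R) ^+ 2) i.
    have irho : i <= rho ^+ 2.
      rewrite expr_div_n ler_pdivlMr ?exprn_gt0 ?mulr_gt0 // [i ^+ 2]expr2.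
      by rewrite ler_wpM2l // ltW.
    apply: (@lt_le_trans _ _ ((rho ^+ 2) ^+ 8)).
      apply: (@lt_le_trans _ _ (i ^+ 8)); last by rewrite lerXn2r // nnegrE ltW // exprn_gt0; lra.
      rewrite ltr_eXn2l //; apply: lt_le_trans i28; rewrite exprn_egt1 //; lra.
    by rewrite -exprM ler_weXn2l //; [lra|clear -k16; lia].
  have k224 : (224 <= k)%N.
    rewrite leqNgt; apply/negP => klt.
    have : (60 * k%:R) ^+ 2 <= 2 ^+ 28 :> R.
      rewrite (exprM 2 14 2) lerXn2r ?nnegrE ?exprn_ge0 ?mulr_ge0 //.
      rewrite -natrX -natrM ler_nat; apply: (@leq_trans (60 * 224)); last by [].
      by rewrite leq_mul2l ltnW.
    by move=> /(lt_le_trans ik2); rewrite ltNge i28.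
  apply: (@lt_trans _ _ (((60 * k%:R) ^+ 2) ^+ 6)).
    by rewrite ltrXn2r // ltW // exprn_gt0 ?mulr_gt0.
  rewrite -exprM; apply: (@lt_le_trans _ _ (2 ^+ k)).
    by rewrite -natrM -!natrX ltr_nat ltn_expn12_exp2.
  apply: (@le_trans _ _ (rho ^+ k)); first by rewrite lerXn2r // nnegrE; lra.
  by rewrite ler_weXn2l //; lra.
have [] := @dense_cycles _ e e_sym e_irr R (26 * k%:R) rho k 1 (2 * k) X.
- by lra.
- by lra.
- exact: le_lt_trans rhoX.
- apply: lt_le_trans iX; rewrite ltr_pM2r; last by lra.
  have -> : 2 * (26 * k%:R) * rho = 52 / 60 * i by rewrite /rho; field; lra.
  by lra.
- move=> F FX F0 F1; apply: (@lt_le_trans _ _ (26 * k%:R * 1)); last first.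
    by rewrite ler_wpM2l ?alphaR_ge1 //; lra.
  by apply: le_lt_trans (_ : 1 < _); [rewrite (ler_nat _ _ 1) | lra].
- move=> F FX F1; have F0 : F != finset.set0 by rewrite -card_gt0 F1.
  apply: (@lt_le_trans _ _ (26 * k%:R * 1)); last first.
    by rewrite ler_wpM2l ?alphaR_ge1 //; lra.
  by rewrite natrD !natrM; lra.
move=> J /andP[J0 Jk] cyc.
have -> : (2 * k + 1 = (2 * (k - J) + 1) + 2 * J)%N by clear -Jk; lia.
by apply: cyc; clear -J0 Jk; lia.
Qed.

(* 1980 = 60 * 33, where 33 = 2 * 16 + 1 is the shortest length used. *)
Lemma polynomial_size_Lodd X i : X != finset.set0 -> 2 ^+ 28 <= i ->
  i * (alpha e X)%:R <= #|X|%:R -> #|X|%:R <= i ^+ 6 ->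
  1 / 2 * ln (i / 1980) <= Lodd R e.
Proof.
move=> X0 i28 iX Xi.
have i0 : 0 < i by apply: lt_le_trans i28; rewrite exprn_gt0.
pose K := Num.truncn (i / 120).
have i120 : 0 <= i / 120 by rewrite divr_ge0 // ltW.
have /andP[K_le K_gt] : K%:R <= i / 120 < K.+1%:R by apply: truncn_itv.
have K16 : (16 <= K)%N.
  rewrite -ltnS -(ltr_nat R); apply: le_lt_trans K_gt.
  rewrite ler_pdivlMr //; apply: le_trans i28; rewrite -natrX -natrM ler_nat.
  by [].
apply: le_trans (_ : 1 / 2 * ln ((2 * 16 + 1 + 2 * (K - 15))%:R / (2 * 16 + 1)%:R) <= _); last first.
  apply: Lodd_ge_interval => // j jK.
  have -> : (2 * 16 + 1 + 2 * j = 2 * (16 + j) + 1)%N by clear; lia.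
  apply: polynomial_size_cycles X0 i28 iX Xi _ _; first exact: leq_addr.
  rewrite mulrC -ler_pdivlMr //; apply: le_trans K_le; rewrite ler_nat.
  by clear -jK K16; lia.
rewrite ler_pM2l; last by lra.
rewrite ler_ln ?posrE ?divr_gt0 ?ltr0n //.
have -> : (2 * 16 + 1 + 2 * (K - 15) = 2 * K.+1 + 1)%N by clear -K16; lia.
rewrite -[(2 * 16 + 1)%N]/33%N ler_pdivlMr // natrD natrM.
have h : 2 * (i / 120) <= 2 * K.+1%:R by rewrite ler_pM2l // ltW.
by lra.
Qed.

End Dichotomy.

Section Main.
Variables (R : realType) (T : finType) (e : rel T).
Hypotheses (e_sym : symmetric e) (e_irr : irreflexive e).
Implicit Types (X S : {set T}) (i : R).

Lemma ln_div_pow2 (c : R) n i : 0 < c -> c <= 2 ^+ n -> 0 < i ->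
  ln i - n%:R <= ln (i / c).
Proof.
move=> c0 cn i0; rewrite ln_div ?posrE // lerB //; exact: ln_nat_pow2.
Qed.

(* Each logarithm contributes 16 to [ln i] and hence to [ln n], so the bound improves
   itself: one logarithm gives [ln n > 16], hence a second one, then a third. *)
Lemma ln_large i n : 0 < i -> i <= n%:R -> 8 * (logstar (n%:R : R))%:R < 1 / 2 * ln i ->
  [/\ 2 ^+ 48 <= i, (3 <= logstar (n%:R : R))%N & 1 <= ln (n%:R : R)].
Proof.
move=> i0 in_ hi; have n0 : 0 < n%:R :> R by apply: lt_le_trans in_.
have n1 : 1 <= n%:R :> R by rewrite (ler_nat _ 1); rewrite ltr0n in n0.
have ln_in : ln i <= ln (n%:R : R) by rewrite ler_ln ?posrE.
have lb k : (k <= logstar (n%:R : R))%N -> 16 * k%:R <= ln i.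
  move: hi; move: (logstar _) => l hi; rewrite -(ler_nat R).
  by move: hi; move: (l%:R) (k%:R) => a b; lra.
have l1 := lb 1%N; rewrite (logstar_ln n1) in l1 lb *.
have {}l1 := l1 isT.
have lnn1 : 1 <= ln (n%:R : R) by lra.
rewrite (logstar_ln lnn1) in lb *; have {}l2 := lb 2%N isT.
have lnlnn1 : 1 <= ln (ln (n%:R : R)).
  apply: le_trans (_ : ln (2 ^+ 2) <= _).
    by have /andP[] := ln2_bounds R; rewrite lnXn // (mulr2n (ln 2)); lra.
  rewrite ler_ln ?posrE ?exprn_gt0 //; last by lra.
  by rewrite expr2; lra.
rewrite (logstar_ln lnlnn1) in lb *; have {}l3 := lb 3%N isT.
split=> //; rewrite -ler_ln ?posrE ?exprn_gt0 // lnXn // -[ln 2 *+ 48]mulr_natr.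
apply: le_trans (_ : 1 * 48%:R <= _); first by rewrite ler_wpM2r //; have /andP[] := ln2_bounds R.
by lra.
Qed.

Lemma Lodd_ge_set X i : X != finset.set0 -> i * (alpha e X)%:R <= #|X|%:R ->
  1 / 2 * ln i - 8 * (logstar (#|X|%:R : R))%:R <= Lodd R e.
Proof.
have [N] := ubnP #|X|; elim: N X i => // N IHN X i XN X0 iX.
have [hi|hi] := leP (1 / 2 * ln i) (8 * (logstar (#|X|%:R : R))%:R).
  by apply: le_trans (Lodd_ge0 R e); rewrite subr_le0.
have i0 : 0 < i.
  rewrite ltNge; apply/negP => /ln0 ln_i; move: hi; rewrite ln_i mulr0 ltNge.
  by rewrite mulr_ge0.
have i_ge0 := ltW i0.
have a1 : 1 <= (alpha e X)%:R :> R by rewrite (ler_nat _ 1) alpha_gt0.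
have in_ : i <= #|X|%:R by apply: le_trans iX; rewrite ler_peMr // ltW.
have [i48 log3 lam1] := ln_large i0 in_ hi.
have n1 : 1 <= #|X|%:R :> R.
  by apply: le_trans in_; apply: le_trans i48; rewrite exprn_ege1 // ler1n.
set lam := ln (#|X|%:R : R) in lam1.
have log_lam : logstar (#|X|%:R : R) = (logstar lam).+1 by apply: logstar_ln.
have pow2 k : (k <= 48)%N -> 2 ^+ k <= i.
  by move=> k48; apply: le_trans i48; rewrite ler_weXn2l // ler1n.
have i20 : 2 ^+ 43 <= i / 20.
  rewrite ler_pdivlMr //; apply: le_trans i48; rewrite (exprD 2 43 5).
  by rewrite ler_pM2l ?exprn_gt0 // -natrX ler_nat.
have le20 : 20 <= 2 ^+ 43 :> R.
  apply: le_trans (_ : 2 ^+ 5 <= _); first by rewrite -natrX ler_nat.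
  by rewrite ler_weXn2l // ler1n.
have [h|[S1 [S1X S10 S1le iS1]]] := small_dense_subset e_sym e_irr X0
    (le_trans le20 (pow2 43%N isT)) iX.
  by apply: le_trans h; rewrite gerBl mulr_ge0.
have log3R : 3 <= (logstar (#|X|%:R : R))%:R :> R by rewrite (ler_nat _ 3).
have [small|large] := leP (i ^+ 4) lam; last first.
  have Slarge : #|S1|%:R <= (i / 20) ^+ 6.
    apply: le_trans S1le _; apply: le_trans (_ : 40 * i * i ^+ 4 <= _).
      by rewrite ler_wpM2l ?mulr_ge0 // ltW.
    rewrite expr_div_n ler_pdivlMr ?exprn_gt0 //.
    have -> : 40 * i * i ^+ 4 * 20 ^+ 6 = 40 * 20 ^+ 6 * i ^+ 5 by ring.
    rewrite [i ^+ 6]exprS ler_wpM2r ?exprn_ge0 //.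
    apply: le_trans (_ : 2 ^+ 36 <= _); last exact: pow2.
    rewrite mulrC (exprD 2 30 6) (exprM 2 5 6) ler_pM ?exprn_ge0 //.
      by rewrite lerXn2r ?nnegrE ?exprn_ge0 // -natrX ler_nat.
    by rewrite -natrX ler_nat.
  have := polynomial_size_Lodd e_sym e_irr S10 (le_trans _ i20) iS1 Slarge.
  rewrite ler_weXn2l ?ler1n // => /(_ isT); apply: le_trans.
  have c1 : ln i - 6%:R <= ln (i / 20).
    by apply: ln_div_pow2; rewrite // -natrX ler_nat.
  have c2 : ln (i / 20) - 11%:R <= ln (i / 20 / 1980).
    apply: ln_div_pow2; [by rewrite ltr0n | | by rewrite divr_gt0].
    by rewrite -natrX ler_nat.
  by move: log3R c1 c2; move: ((logstar _)%:R) => L; lra.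
have [h|[S2 [S2S1 S20 S2le iS2]]] := small_dense_subset e_sym e_irr S10
    (le_trans le20 i20) iS1.
  apply: le_trans h; have c1 : ln i - 6%:R <= ln (i / 20).
    by apply: ln_div_pow2; rewrite // -natrX ler_nat.
  by move: log3R c1; move: ((logstar _)%:R) => L; lra.
have lam0 : 0 < lam by lra.
have lam_ge0 := ltW lam0.
have S2lam : #|S2|%:R <= lam.
  apply: le_trans S2le _.
  have S1lam : #|S1|%:R <= lam ^+ 2.
    apply: le_trans S1le _; rewrite expr2 ler_wpM2r //; apply: le_trans small.
    rewrite exprSr ler_wpM2r //; apply: le_trans (_ : 2 ^+ 6 <= _).
      by rewrite -natrX ler_nat.
    apply: le_trans (pow2 6%N isT) _; rewrite -[leLHS]expr1 ler_weXn2l //.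
    exact: pow2 0%N isT.
  have w0 : 0 < Num.sqrt lam by rewrite sqrtr_gt0.
  have wE : Num.sqrt lam ^+ 2 = lam by rewrite sqr_sqrtr // ltW.
  set w := Num.sqrt lam in w0 wE; have w_ge0 := ltW w0.
  have lnS1 : ln (#|S1|%:R : R) <= 4 * w.
    apply: le_trans (_ : ln (lam ^+ 2) <= _).
      by rewrite ler_ln ?posrE ?exprn_gt0 // ltr0n card_gt0.
    rewrite -wE -exprM lnXn // -[ln w *+ _]mulr_natr mulrC ler_wpM2l //.
    apply/ltW; exact: ln_sublinear.
  have iw : 8 * i <= w.
    rewrite -(ler_pXn2r (isT : (0 < 2)%N)) ?nnegrE ?mulr_ge0 // wE.
    apply: le_trans small; rewrite exprMn (exprD i 2 2) ler_wpM2r ?exprn_ge0 //.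
    rewrite lerXn2r ?nnegrE //; apply: le_trans (pow2 3%N isT).
    by rewrite -natrX ler_nat.
  apply: le_trans (_ : 40 * (i / 20) * (4 * w) <= _).
    by rewrite ler_wpM2l // ?mulr_ge0 ?divr_ge0 // ltW.
  have -> : 40 * (i / 20) * (4 * w) = 8 * i * w by field.
  by rewrite -wE expr2 ler_wpM2r // ltW.
have S2N : (#|S2| < N)%N.
  apply: leq_trans (_ : #|X| <= _)%N; last by rewrite -ltnS.
  rewrite -(ltr_nat R); apply: le_lt_trans S2lam _.
  by apply: ln_sublinear; lra.
apply: le_trans (IHN S2 (i / 20 / 20) S2N S20 iS2).
have c1 : ln i - 6%:R <= ln (i / 20).
  by apply: ln_div_pow2; rewrite // -natrX ler_nat.
have c2 : ln (i / 20) - 6%:R <= ln (i / 20 / 20).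
  by apply: ln_div_pow2; rewrite ?divr_gt0 // -natrX ler_nat.
have : (logstar (#|S2|%:R : R)).+1%:R <= (logstar (#|X|%:R : R))%:R :> R.
  by rewrite ler_nat log_lam ltnS logstar_le.
rewrite -natr1; move: log3R c1 c2; move: ((logstar _)%:R) ((logstar _)%:R) => L L2.
by lra.
Qed.

End Main.

Theorem theorem5 (R : realType) (T : finType) (e : rel T)
    (e_sym : symmetric e) (e_irr : irreflexive e) :
  Lodd R e >= 1 / 2 * ln (iota_ratio R e) - 8 * (logstar (#|T|%:R : R))%:R.
Proof.
set b := Lodd R e + 8 * (logstar (#|T|%:R : R))%:R.
have b0 : 0 <= b by rewrite addr_ge0 ?Lodd_ge0 ?mulr_ge0.
rewrite lerBlDr -/b.
have [i0|i0] := leP (iota_ratio R e) 0; first by rewrite ln0 ?mulr0.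
suff le_exp : iota_ratio R e <= expR (2 * b).
  have : ln (iota_ratio R e) <= 2 * b.
    by rewrite -[leRHS]expRK ler_ln ?posrE // expR_gt0.
  by lra.
apply: ge_sup.
  apply/set0P/negP => /eqP E; move: i0; rewrite /iota_ratio E sup0.
  by rewrite ltxx.
move=> r [X X0 ->].
have a0 : 0 < (alpha e X)%:R :> R by rewrite ltr0n alpha_gt0.
have n0 : 0 < #|X|%:R :> R by rewrite ltr0n card_gt0.
have /(Lodd_ge_set e_sym e_irr X0) : #|X|%:R / (alpha e X)%:R * (alpha e X)%:R <= #|X|%:R :> R.
  by rewrite divfK // gt_eqF.
rewrite lerBlDr => H.
have : (logstar (#|X|%:R : R))%:R <= (logstar (#|T|%:R : R))%:R :> R.
  by rewrite ler_nat logstar_le // ler_nat max_card.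
move: H; rewrite /b; move: ((logstar _)%:R) ((logstar _)%:R) => L1 L2 H H2.
rewrite -ler_ln ?posrE ?divr_gt0 ?expR_gt0 // expRK.
by lra.
Qed.
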